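(* Let $R=1$. For every choice of the model and variational parameters of the GP formulation, namely kernels $k^{(l)}$ and parameters $Q^{(l)},\mu_0^{(l)},Q_0^{(l)},m_0^{(l)},S_0^{(l)},m_M^{(l,d)},S_M^{(l,d)}$ ($1\le l\le L$, $1\le d\le D_l$), $C$, $\Omega$, there exists a choice of the corresponding model and variational parameters of the SDE formulation (kernels $k^{\Delta,(l)}$ and parameters $Q^{\Delta,(l)},\mu_0^{\Delta,(l)},Q_0^{\Delta,(l)},m_0^{\Delta,(l)},S_0^{\Delta,(l)},m_M^{\Delta,(l,d)},S_M^{\Delta,(l,d)},C^\Delta,\Omega^\Delta$), expressed in terms of the parameters of the GP formulation and of the time step $\Delta_t$ (and not depending on the observations), such that for all observations $y_1,\dots,y_T$ the two lower bounds coincide: $\mathcal L=\mathcal L_\Delta$.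
   Context: $\mathcal N(x\mid m,S)$ is the Gaussian density with mean $m$ and covariance $S$. Observations $y_1,\dots,y_T\in\mathbb R^{D_y}$ are given, with time $\Delta_t>0$ between adjacent observations. All covariance parameters are symmetric positive definite, kernels are measurable positive semidefinite functions, and all kernel matrices at the inducing inputs are invertible. The latent state $x=(x^{(1)},\dots,x^{(L)})$ splits into $L$ components $x^{(l)}\in\mathbb R^{D_l}$, $\sum_l D_l=D_x$. Component $l$ has a kernel $k^{(l)}:\mathbb R^{D_l}\times\mathbb R^{D_l}\to\mathbb R$, fixed inducing inputs $z^{(l)}_1,\dots,z^{(l)}_M\in\mathbb R^{D_l}$ (the same in both formulations), and, for each latent dimension $d\in\{1,\dots,D_l\}$, a vector of inducing outputs $f_M^{(l,d)}\in\mathbb R^M$ (independent over $d$). Put $K^{(l)}_{MM}=(k^{(l)}(z^{(l)}_m,z^{(l)}_{m'}))_{m,m'}$, $K^{(l)}_{xM}=(k^{(l)}(x,z^{(l)}_m))_{m}$ (a row vector). For $x\in\mathbb R^{D_l}$ let $\mu^{(l)}(x)\in\mathbb R^{D_l}$ have $d$-th entry $K^{(l)}_{xM}(K^{(l)}_{MM})^{-1}f_M^{(l,d)}$, and let $\Sigma^{(l)}(x)=\big(k^{(l)}(x,x)-K^{(l)}_{xM}(K^{(l)}_{MM})^{-1}(K^{(l)}_{xM})^\top\big)I_{D_l}$. GP formulation. Prior: $p(x_0^{(l)})=\mathcal N(x_0^{(l)}\mid\mu_0^{(l)},Q_0^{(l)})$, $p(f_M^{(l,d)})=\mathcal N(f_M^{(l,d)}\mid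 0,K^{(l)}_{MM})$, all independent over $l,d$. Transition: $p(x^{(l)}_{t+1}\mid x^{(l)}_t,f_M^{(l)})=\mathcal N(x^{(l)}_{t+1}\mid x^{(l)}_t+\mu^{(l)}(x^{(l)}_t),\,Q^{(l)}+\Sigma^{(l)}(x^{(l)}_t))$, where $f_M^{(l)}=(f_M^{(l,d)})_d$. Emission: $p(y_t\mid x_t)=\mathcal N(y_t\mid Cx_t,\Omega)$ with $C\in\mathbb R^{D_y\times D_x}$. Variational factors: $q(x_0^{(l)})=\mathcal N(x_0^{(l)}\mid m_0^{(l)},S_0^{(l)})$, $q(f_M^{(l,d)})=\mathcal N(f_M^{(l,d)}\mid m_M^{(l,d)},S_M^{(l,d)})$. With $q(x_0)=\prod_l q(x_0^{(l)})$, $q(f_M)=\prod_{l,d}q(f_M^{(l,d)})$ (and likewise for $p$), the variational posterior is $q(x_0,\dots,x_T,f_M)=q(x_0)\,q(f_M)\prod_{t=0}^{T-1}\prod_{l=1}^L p(x^{(l)}_{t+1}\mid x^{(l)}_t,f_M^{(l)})$, and $q(x_t)$ denotes its marginal on $x_t$. The lower bound is $$\mathcal L=\sum_{t=1}^T\mathbb E_{q(x_t)}[\log p(y_t\mid x_t)]-\mathrm{KL}(q(x_0)\,\|\,p(x_0))-\mathrm{KL}(q(f_M)\,\|\,p(f_M)).$$ (The integrand $\log p(y_t\mid x_t)$ is bounded above, so each expectation is well defined in $[-\infty,\infty)$.) SDE formulation with integer resolution $R\ge1$, $J=T/R$. It is defined identically with all parameters and kernels carrying a superscript $\Delta$ (so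 $\mu^{\Delta,(l)}(x)$, $\Sigma^{\Delta,(l)}(x)$ are built from $k^{\Delta,(l)}$ and the same inducing inputs, and $p^\Delta(x_0),p^\Delta(f_M),q^\Delta(x_0),q^\Delta(f_M)$, $p^\Delta(y_j\mid x_j)=\mathcal N(y_j\mid C^\Delta x_j,\Omega^\Delta)$ are the analogous Gaussians), with time indices $j=0,\dots,J$ where index $j$ corresponds to time $jR\Delta_t$ ($y_j$ is the observation at that time; for $R=1$ it is the $j$-th observation), except that the transition is the Euler–Maruyama step $$p^\Delta(x^{(l)}_{j+1}\mid x^{(l)}_j,f_M^{(l)})=\mathcal N\big(x^{(l)}_{j+1}\mid x^{(l)}_j+R\Delta_t\,\mu^{\Delta,(l)}(x^{(l)}_j),\ (R\Delta_t)^2\Sigma^{\Delta,(l)}(x^{(l)}_j)+R\Delta_t\,Q^{\Delta,(l)}\big).$$ The lower bound is $$\mathcal L_\Delta=\sum_{j=1}^J\mathbb E_{q^\Delta(x_j)}[\log p^\Delta(y_j\mid x_j)]-\mathrm{KL}(q^\Delta(x_0)\,\|\,p^\Delta(x_0))-\mathrm{KL}(q^\Delta(f_M)\,\|\,p^\Delta(f_M)),$$ where $q^\Delta(x_j)$ is the marginal on $x_j$ of $q^\Delta(x_0)q^\Delta(f_M)\prod_{j'=0}^{J-1}\prod_l p^\Delta(x^{(l)}_{j'+1}\mid x^{(l)}_{j'},f_M^{(l)})$. *)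

(* Defs.v *)
From HB Require Import structures.
From mathcomp Require Import all_boot all_order all_algebra.
From mathcomp Require Import all_classical all_reals all_analysis.

Set Implicit Arguments.
Unset Strict Implicit.
Unset Printing Implicit Defensive.

Import Order.TTheory GRing.Theory Num.Theory.
Import numFieldNormedType.Exports.

Local Open Scope classical_set_scope.
Local Open Scope ring_scope.

Fact mx_display : measure_display. Proof. exact: default_measure_display. Qed.

(* The sigma-algebra on matrices generated by the entries, i.e. the Borel
   sigma-algebra of R^(m * n). *)
Section measurable_matrix.
Context {R : realType} (m n : nat).

Definition mx_coor (k : 'I_(m * n)) (A : 'M[R]_(m, n)) : measurableTypeR R :=
  mxvec A ord0 k.

Let mx_set0 : g_sigma_preimage mx_coor set0.
Proof. exact: sigma_algebra0. Qed.

Let mx_setC A : g_sigma_preimage mx_coor A -> g_sigma_preimage mx_coor (~` A).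
Proof. exact: sigma_algebraC. Qed.

Let mx_bigcup (F : _^nat) : (forall i, g_sigma_preimage mx_coor (F i)) ->
  g_sigma_preimage mx_coor (\bigcup_i (F i)).
Proof. exact: sigma_algebra_bigcup. Qed.

HB.instance Definition _ := @isMeasurable.Build mx_display
  'M[R]_(m, n) (g_sigma_preimage mx_coor) mx_set0 mx_setC mx_bigcup.

End measurable_matrix.

Section lebesgue_matrix.
Context (R : realType).
Local Open Scope ereal_scope.

Definition tuple_cons n (p : measurableTypeR R * n.-tuple (measurableTypeR R)) :
  n.+1.-tuple (measurableTypeR R) := [tuple of p.1 :: p.2].

Fixpoint lebesgue_tuple n : set (n.-tuple (measurableTypeR R)) -> \bar R :=
  if n is n'.+1
  then pushforward (lebesgue_measure \x @lebesgue_tuple n') (@tuple_cons n')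
  else \d_[tuple].

Definition mx_of_tuple m n (v : (m * n).-tuple (measurableTypeR R)) :
  'M[R]_(m, n) := vec_mx (\row_k tnth v k).

Definition lebesgue_mx m n : set 'M[R]_(m, n) -> \bar R :=
  pushforward (@lebesgue_tuple (m * n)) (@mx_of_tuple m n).

End lebesgue_matrix.

Section lebesgue_sigma_finite.
Context (R : realType).
Local Open Scope ereal_scope.

Section pushforward_can.
Context d d' (T1 : measurableType d) (T2 : measurableType d').
Context (mu : {measure set T1 -> \bar R}) (sfmu : sigma_finite setT mu).
Context (f : T1 -> T2) (g : T2 -> T1).
Hypotheses (mf : measurable_fun setT f) (mg : measurable_fun setT g).
Hypothesis fK : cancel f g.

Let nu := pushforward mu f.

Let nu0 : nu set0 = 0.
Proof. by rewrite /nu /pushforward preimage_set0 measure0. Qed.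

Let nu_ge0 A : 0 <= nu A. Proof. exact: measure_ge0. Qed.

Let nu_sigma_additive : semi_sigma_additive nu.
Proof.
move=> F mF tF mUF; rewrite /nu /pushforward preimage_bigcup.
apply: measure_semi_sigma_additive.
- by move=> n; rewrite -[X in measurable X]setTI; exact: mf.
- apply/trivIsetP => /= i j _ _ ij; rewrite -preimage_setI.
  by move/trivIsetP : tF => /(_ _ _ _ _ ij) ->//; rewrite preimage_set0.
- by rewrite -preimage_bigcup -[X in measurable X]setTI; exact: mf.
Qed.

HB.instance Definition _ := isMeasure.Build _ _ _ nu
  nu0 nu_ge0 nu_sigma_additive.

Let nu_sigma_finite : sigma_finite setT nu.
Proof.
have [F FT Ffin] := sfmu.
exists (fun i => g @^-1` F i); first by rewrite -preimage_bigcup -FT.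
move=> i; have [mFi Fioo] := Ffin i; split.
  by rewrite -[X in measurable X]setTI; exact: mg.
rewrite /nu /pushforward (_ : f @^-1` _ = F i)//.
by apply/seteqP; split=> x /=; rewrite fK.
Qed.

HB.instance Definition _ := Measure_isSigmaFinite.Build _ _ _ nu nu_sigma_finite.

Lemma pushforward_can_sigma_finite :
  exists m : {sigma_finite_measure set T2 -> \bar R}, pushforward mu f = m.
Proof. by exists nu. Qed.

End pushforward_can.

Lemma measurable_tuple_cons n : measurable_fun setT (@tuple_cons R n).
Proof. exact: measurable_cons. Qed.

Lemma product_sigma_finite d1 d2 (T1 : measurableType d1)
    (T2 : measurableType d2) (m1 : {sigma_finite_measure set T1 -> \bar R})
    (m2 : {sigma_finite_measure set T2 -> \bar R}) :
  sigma_finite setT (m1 \x m2).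
Proof.
have /sigma_finiteP[F [TF ndF Foo]] := sigma_finiteT m1.
have /sigma_finiteP[G [TG ndG Goo]] := sigma_finiteT m2.
exists (fun n => F n `*` G n).
  rewrite -setXTT TF TG predeqE => -[x y]; split.
    move=> [/= [n _ Fnx] [k _ Gky]]; exists (maxn n k) => //; split.
    - by move: x Fnx; exact/subsetPset/ndF/leq_maxl.
    - by move: y Gky; exact/subsetPset/ndG/leq_maxr.
  by move=> [n _ []/= ? ?]; split; exists n.
move=> k; have [? ?] := Foo k; have [? ?] := Goo k.
split; first exact: measurableX.
by rewrite product_measure1E// lte_mul_pinfty// ge0_fin_numE.
Qed.

Lemma lebesgue_tupleP n :
  exists m : {sigma_finite_measure set (n.-tuple (measurableTypeR R)) -> \bar R},
    @lebesgue_tuple R n = m.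
Proof.
elim: n => [|n [m IH]] /=; first by exists \d_[tuple].
rewrite IH; apply: (@pushforward_can_sigma_finite _ _ _ _ (lebesgue_measure \x m)%E
  _ _ (fun t => (thead t, [tuple of behead t]))).
- exact: product_sigma_finite.
- exact: measurable_tuple_cons.
- apply/measurable_fun_pair; first exact: measurable_tnth.
  exact: measurable_behead.
- by move=> [x t]; rewrite /tuple_cons theadE; congr pair; exact: val_inj.
Qed.

Definition tuple_of_mx m n (A : 'M[R]_(m, n)) :
  (m * n).-tuple (measurableTypeR R) := [tuple mx_coor k A | k < m * n].

Lemma mx_of_tupleK m n : cancel (@mx_of_tuple R m n) (@tuple_of_mx m n).
Proof.
move=> t; apply: eq_from_tnth => k.
by rewrite tnth_mktuple /mx_coor /mx_of_tuple vec_mxK mxE.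
Qed.

Lemma measurable_mx_coor m n (k : 'I_(m * n)) :
  measurable_fun setT (@mx_coor R m n k).
Proof.
move=> _ Y mY; rewrite setTI; apply: sub_sigma_algebra => /=.
rewrite -bigcup_seq/=; exists k => /=; first by rewrite mem_index_enum.
by exists Y => //; rewrite setTI.
Qed.

Lemma measurable_tuple_of_mx m n : measurable_fun setT (@tuple_of_mx m n).
Proof.
apply/measurable_fun_tnthP => k.
rewrite (_ : _ \o _ = mx_coor k); first exact: measurable_mx_coor.
by apply/funext => A /=; rewrite tnth_mktuple.
Qed.

Lemma measurable_mx_of_tuple m n : measurable_fun setT (@mx_of_tuple R m n).
Proof.
move=> _ A mA; rewrite setTI.
suff : g_sigma_preimage (fun k => @mx_coor R m n k \o @mx_of_tuple R m n)
    (@mx_of_tuple R m n @^-1` A).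
  rewrite (_ : (fun k => _) = fun k t => tnth t k)//.
  apply/funext => k; apply/funext => t /=.
  by rewrite /mx_coor /mx_of_tuple vec_mxK mxE.
by rewrite g_sigma_preimage_comp; exists A => //; rewrite setTI.
Qed.

Lemma lebesgue_mxP m n :
  exists nu : {sigma_finite_measure set 'M[R]_(m, n) -> \bar R},
    @lebesgue_mx R m n = nu.
Proof.
rewrite /lebesgue_mx; have [nu ->] := lebesgue_tupleP (m * n).
apply: (pushforward_can_sigma_finite (sigma_finiteT nu) _ _ (@mx_of_tupleK m n)).
- exact: measurable_mx_of_tuple.
- exact: measurable_tuple_of_mx.
Qed.

Let lebesgue_mx0 m n : @lebesgue_mx R m n set0 = 0.
Proof. by have [nu ->] := lebesgue_mxP m n; exact: measure0. Qed.

Let lebesgue_mx_ge0 m n A : 0 <= @lebesgue_mx R m n A.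
Proof. by have [nu ->] := lebesgue_mxP m n; exact: measure_ge0. Qed.

Let lebesgue_mx_sigma_additive m n :
  semi_sigma_additive (@lebesgue_mx R m n).
Proof.
by have [nu ->] := lebesgue_mxP m n; exact: measure_semi_sigma_additive.
Qed.

HB.instance Definition _ m n := isMeasure.Build _ _ _ (@lebesgue_mx R m n)
  (@lebesgue_mx0 m n) (@lebesgue_mx_ge0 m n) (@lebesgue_mx_sigma_additive m n).

Let lebesgue_mx_sigma_finite m n : sigma_finite setT (@lebesgue_mx R m n).
Proof. by have [nu ->] := lebesgue_mxP m n; exact: sigma_finiteT. Qed.

HB.instance Definition _ m n := Measure_isSigmaFinite.Build _ _ _
  (@lebesgue_mx R m n) (@lebesgue_mx_sigma_finite m n).

End lebesgue_sigma_finite.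

Section gaussian.
Context (R : realType).

Definition is_spd n (S : 'M[R]_n) : Prop :=
  S^T = S /\ forall v : 'cV[R]_n, v != 0 -> 0 < (v^T *m S *m v) 0 0.

Definition gauss_pdf n (m : 'cV[R]_n) (S : 'M[R]_n) (x : 'cV[R]_n) : R :=
  (Num.sqrt ((2 * pi) ^+ n * \det S))^-1 *
  expR (- ((x - m)^T *m invmx S *m (x - m)) 0 0 / 2).

Local Open Scope ereal_scope.

(* With 0 * (+-oo) = 0, the integrand is 0 where q vanishes, and +oo where only
   p vanishes. *)
Definition kl_div d (X : measurableType d) (mu : set X -> \bar R)
    (q p : X -> R) : \bar R :=
  \int[mu]_x ((q x)%:E * (lne (q x)%:E - lne (p x)%:E)).

End gaussian.

Definition psd_kernel (R : realType) (X : Type) (k : X -> X -> R) : Prop :=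
  (forall x y, k x y = k y x) /\
  forall (n : nat) (x : 'I_n -> X) (c : 'I_n -> R),
    0 <= \sum_(i < n) \sum_(j < n) c i * c j * k (x i) (x j).

(* Model and variational parameters; both formulations have the same ones. *)
Record params (R : realType) (L M Dy : nat) (D : 'I_L -> nat) := Params {
  kern : forall l, 'cV[R]_(D l) -> 'cV[R]_(D l) -> R ;
  Qnoise : forall l, 'M[R]_(D l) ;
  mu0 : forall l, 'cV[R]_(D l) ;
  Q0 : forall l, 'M[R]_(D l) ;
  m0 : forall l, 'cV[R]_(D l) ;
  S0 : forall l, 'M[R]_(D l) ;
  mM : forall l, 'I_(D l) -> 'cV[R]_M ;
  SM : forall l, 'I_(D l) -> 'M[R]_M ;
  Cobs : 'M[R]_(Dy, \sum_(l < L) D l) ;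
  Omega : 'M[R]_Dy }.

(* A state is a column vector whose l-th block [submxcol x l] is the component
   x^(l).  Likewise the inducing outputs of all components form a matrix f whose
   l-th block [submxrow f l] has the vectors f_M^(l,d) as columns.  A trajectory
   x_0, ..., x_J is the matrix having these states as columns. *)
Section model.
Context (R : realType) (L M Dy : nat) (D : 'I_L -> nat).
Local Notation Dx := (\sum_(l < L) D l)%N.
Local Notation state := 'cV[R]_Dx.
Local Notation outputs := 'M[R]_(M, Dx).
Context (z : forall l, 'I_M -> 'cV[R]_(D l)) (th : params R M Dy D).

Definition KMM l : 'M[R]_M := \matrix_(i, j) kern th (z l i) (z l j).

Definition KxM l (x : 'cV[R]_(D l)) : 'rV[R]_M := \row_j kern th x (z l j).

Definition drift l (x : 'cV[R]_(D l)) (f : 'M[R]_(M, D l)) : 'cV[R]_(D l) :=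
  \col_d (KxM x *m invmx (KMM l) *m col d f) 0 0.

Definition cond_cov l (x : 'cV[R]_(D l)) : 'M[R]_(D l) :=
  (kern th x x - (KxM x *m invmx (KMM l) *m (KxM x)^T) 0 0)%:M.

Definition admissible : Prop :=
  [/\ forall l, measurable_fun setT
        (fun w : 'cV[R]_(D l) * 'cV[R]_(D l) => kern th w.1 w.2 : measurableTypeR R),
      forall l, psd_kernel (kern th (l := l)),
      forall l, KMM l \in unitmx,
      forall l, [/\ is_spd (Qnoise th l), is_spd (Q0 th l), is_spd (S0 th l)
        & forall d, is_spd (SM th (l := l) d)]
    & is_spd (Omega th)].

Definition prior_x0 (x : state) : R :=
  \prod_(l < L) gauss_pdf (mu0 th l) (Q0 th l) (submxcol x l).

Definition prior_f (f : outputs) : R :=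
  \prod_(l < L) \prod_(d < D l) gauss_pdf 0 (KMM l) (col d (submxrow f l)).

Definition var_x0 (x : state) : R :=
  \prod_(l < L) gauss_pdf (m0 th l) (S0 th l) (submxcol x l).

Definition var_f (f : outputs) : R :=
  \prod_(l < L) \prod_(d < D l)
    gauss_pdf (mM th d) (SM th d) (col d (submxrow f l)).

Definition emission (y : 'cV[R]_Dy) (x : state) : R :=
  gauss_pdf (Cobs th *m x) (Omega th) y.

(* [trans l x x' f] is the density at x' of the next value of component l, given
   its current value x and the inducing outputs f of that component. *)
Definition transition := forall l : 'I_L,
  'cV[R]_(D l) -> 'cV[R]_(D l) -> 'M[R]_(M, D l) -> R.

Definition gp_transition : transition := fun l x x' f =>
  gauss_pdf (x + drift x f) (Qnoise th l + cond_cov x) x'.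

Definition em_transition (h : R) : transition := fun l x x' f =>
  gauss_pdf (x + h *: drift x f) (h ^+ 2 *: cond_cov x + h *: Qnoise th l) x'.

Section bound.
Context (trans : transition) (J : nat).

Definition var_posterior (w : 'M[R]_(Dx, J.+1) * outputs) : R :=
  var_x0 (col ord0 w.1) * var_f w.2 *
  \prod_(t < J) \prod_(l < L)
    trans (submxcol (col (widen_ord (leqnSn J) t) w.1) l)
          (submxcol (col (lift ord0 t) w.1) l)
          (submxrow w.2 l).

Local Open Scope ereal_scope.

(* For admissible parameters the density is measurable and this is a
   probability measure. *)
Definition var_posterior_law (A : set ('M[R]_(Dx, J.+1) * outputs)) : \bar R :=
  \int[@lebesgue_mx R Dx J.+1 \x @lebesgue_mx R M Dx]_(w in A)
    (var_posterior w)%:E.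

Definition var_marginal (t : 'I_J.+1) : set state -> \bar R :=
  pushforward var_posterior_law (fun w => col t w.1).

(* Only [obs 1], ..., [obs J] are used. *)
Definition elbo (obs : nat -> 'cV[R]_Dy) : \bar R :=
  (\sum_(j < J)
     \int[var_marginal (lift ord0 j)]_x (ln (emission (obs j.+1) x))%:E)
  - kl_div (@lebesgue_mx R Dx 1) var_x0 prior_x0
  - kl_div (@lebesgue_mx R M Dx) var_f prior_f.

End bound.

Definition elbo_gp (T : nat) (y : nat -> 'cV[R]_Dy) : \bar R :=
  elbo gp_transition T y.

(* Euler-Maruyama steps of length r * Dt: index j is time j * r * Dt, where the
   observation is the (j * r)-th one. *)
Definition elbo_sde (Dt : R) (r T : nat) (y : nat -> 'cV[R]_Dy) : \bar R :=
  elbo (em_transition (r%:R * Dt)) (T %/ r)%N (fun j => y (j * r)%N).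

End model.

(* Main.v *)
Require Import Defs.
From HB Require Import structures.
From mathcomp Require Import all_boot all_order all_algebra.
From mathcomp Require Import all_classical all_reals all_analysis.
From mathcomp Require Import measurable_realfun ring.

Set Implicit Arguments.
Unset Strict Implicit.
Unset Printing Implicit Defensive.

Import Order.TTheory GRing.Theory Num.Theory.
Local Open Scope ring_scope.

(* With h = Dt, take kernels k / h^2 and noise Q / h, and scale the variational
   means and covariances of the inducing outputs by 1 / h and 1 / h^2.  The
   interpolation weights K_xM K_MM^-1 do not change, and the conditional
   covariance is divided by h^2, so the Euler-Maruyama transition given f is the
   GP transition given h f.  The substitution f -> h f in the integrals over the
   inducing outputs then identifies the marginals q(x_t) and preserves the KL
   divergence of f_M, whose two densities both acquire the Jacobian. *)

(** * Change of variables along bijections with constant Jacobian *)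

Section change_of_variables.
Local Open Scope classical_set_scope.
Local Open Scope ereal_scope.
Context {R : realType}.

(* [c] is the Jacobian of the bijection [phi], with inverse [psi]. *)
Definition rescales d (T : measurableType d) (mu : set T -> \bar R) (c : R)
    (phi psi : T -> T) : Prop :=
  [/\ (0 < c)%R, measurable_fun setT phi, measurable_fun setT psi,
      cancel phi psi /\ cancel psi phi &
      forall A, measurable A -> c%:E * mu (phi @^-1` A) = mu A].

Lemma rescalesV d (T : measurableType d) (mu : set T -> \bar R) c phi psi :
  rescales mu c phi psi -> rescales mu c^-1 psi phi.
Proof.
move=> [c0 mphi mpsi [phiK psiK] cmu]; split=> //; first by rewrite invr_gt0.
move=> A mA; rewrite -(cmu (psi @^-1` A)); last first.
  by rewrite -[X in measurable X]setTI; exact: mpsi.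
rewrite -comp_preimage (_ : psi \o phi = id); last exact/funext.
by rewrite preimage_id muleA -EFinM mulVf ?mul1e ?gt_eqF.
Qed.

Lemma rescales_id d (T : measurableType d) (mu : set T -> \bar R) :
  rescales mu 1 id id.
Proof. by split=> // A _; rewrite mul1e preimage_id. Qed.

Section nnsfun_rescale.
Import HBSimple HBNNSimple.
Context d (T : measurableType d) (c : R) (phi : T -> T).
Hypotheses (c0 : (0 < c)%R) (mphi : measurable_fun setT phi).
Variable h : {nnsfun T >-> R}.

Let k x : R := (c * h (phi x))%R.

Let mk : measurable_fun setT k.
Proof.
apply: measurable_funM => //.
exact: (measurableT_comp (measurable_funPT h)).
Qed.

Let fk : finite_set (range k).
Proof.
apply: (@sub_finite_set _ _ ((fun r => c * r)%R @` range h)).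
  by move=> _ [x _ <-]; exists (h (phi x)) => //; exists (phi x).
exact/finite_image/fimfunP.
Qed.

Let k0 x : (0 <= k x)%R.
Proof. by apply: mulr_ge0; [exact: ltW|exact: fun_ge0]. Qed.

HB.instance Definition _ := isMeasurableFun.Build _ _ _ _ k mk.
HB.instance Definition _ := FiniteImage.Build _ _ k fk.
HB.instance Definition _ := isNonNegFun.Build _ _ k k0.

(** Hides the structure instances behind an existential: later proofs only need the values of the
    rescaled simple function. *)
Lemma nnsfun_rescale :
  exists k : {nnsfun T >-> R}, forall x, k x = (c * h (phi x))%R.
Proof. by exists k. Qed.

End nnsfun_rescale.

Section integral.
Import HBSimple HBNNSimple.
Context d (T : measurableType d) (mu : {measure set T -> \bar R}).

(** Each simple [h] below [f] yields the simple function [c * h (phi x)] below the other integrand.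
    Its integral is the same, since its level sets are [phi]-preimages of those of [h]. *)
Let ge0_le_integral_rescale c phi psi (f : T -> \bar R) :
  rescales mu c phi psi -> (forall x, 0 <= f x) ->
  \int[mu]_x f x <= \int[mu]_x (c%:E * f (phi x)).
Proof.
move=> [c0 mphi mpsi _ cmu] f0.
rewrite ge0_integralTE// ge0_integralTE; last first.
  by move=> x; rewrite mule_ge0// lee_fin ltW.
apply: ge_ereal_sup => _ [h /= hf <-].
have [k kE] := nnsfun_rescale c0 mphi h.
apply: ereal_sup_ubound; exists k => /=.
  by move=> x; rewrite kE EFinM lee_pmul2l// lte_fin.
have -> : (k : T -> R) = (cst c \* (h \o phi))%R by exact/funext.
(* The constant 1 gives [h \o phi] itself as a simple function, so that [c] can be taken out of its
   integral. *)
have [g gE] := nnsfun_rescale ltr01 mphi h.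
have {}gE : h \o phi = g by apply/funext => x; rewrite gE mul1r.
rewrite gE sintegralrM -gE !sintegralET ge0_mule_fsumr.
  apply: eq_fsbigr => r _; rewrite muleCA; congr (_ * _).
  by rewrite comp_preimage cmu.
by move=> r; rewrite gE nnsfun_mulemu_ge0.
Qed.

(** The reverse inequality is the previous one for the inverse bijection, applied to the function
    [c * f (phi x)]. *)
Let ge0_integral_rescale c phi psi (f : T -> \bar R) :
  rescales mu c phi psi -> (forall x, 0 <= f x) ->
  \int[mu]_x (c%:E * f (phi x)) = \int[mu]_x f x.
Proof.
move=> H f0; have [c0 _ _ [phiK psiK] _] := H.
apply/eqP; rewrite eq_le (ge0_le_integral_rescale H)// andbT.
apply: le_trans (ge0_le_integral_rescale (rescalesV H) _) _.
  by move=> x; rewrite mule_ge0// lee_fin ltW.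
under eq_integral do rewrite psiK muleA -EFinM mulVf ?gt_eqF// mul1e.
by [].
Qed.

(* No measurability is required of [f]: [phi] acts on the simple functions
   below [f]. *)
Lemma integral_rescale c phi psi (D : set T) (f : T -> \bar R) :
  rescales mu c phi psi ->
  \int[mu]_(x in phi @^-1` D) (c%:E * f (phi x)) = \int[mu]_(x in D) f x.
Proof.
move=> H; have [c0 _ _ _ _] := H.
rewrite integral_mkcond [RHS]integral_mkcond.
transitivity (\int[mu]_x (c%:E * (f \_ D) (phi x))).
  apply: eq_integral => x _; rewrite /patch.
  by rewrite (_ : (x \in phi @^-1` D) = (phi x \in D))//; case: ifP;
    rewrite ?mule0.
rewrite integralE [RHS]integralE.
rewrite -(ge0_integral_rescale (f := (f \_ D)^\+) H)//.
rewrite -(ge0_integral_rescale (f := (f \_ D)^\-) H)//.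
(* A positive constant factor commutes with taking positive and negative parts. *)
by congr (_ - _); apply: eq_integral => x _;
  rewrite ?funeposE ?funenegE maxe_pMr ?mule0 ?muleN// lee_fin ltW.
Qed.

End integral.

(** * Jacobians of products and of scalings of numbers, tuples and matrices *)

(** The product measure integrates the [mu2]-measure of sections over [mu1]: [c2] arises in each
    section, [c1] from the change of variables in the outer integral. *)
Lemma product_rescales d1 d2 (T1 : measurableType d1) (T2 : measurableType d2)
    (mu1 : {sigma_finite_measure set T1 -> \bar R})
    (mu2 : {sigma_finite_measure set T2 -> \bar R}) c1 phi1 psi1 c2 phi2 psi2 :
  rescales mu1 c1 phi1 psi1 -> rescales mu2 c2 phi2 psi2 ->
  rescales (mu1 \x mu2) (c1 * c2) (fun w => (phi1 w.1, phi2 w.2))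
    (fun w => (psi1 w.1, psi2 w.2)).
Proof.
move=> H1 [c20 mphi2 mpsi2 [phi2K psi2K] cmu2].
have [c10 mphi1 mpsi1 [phi1K psi1K] _] := H1.
have mphi : measurable_fun setT (fun w : T1 * T2 => (phi1 w.1, phi2 w.2)).
  by apply/measurable_fun_pair; exact: measurableT_comp.
split=> //.
- exact: mulr_gt0.
- by apply/measurable_fun_pair; exact: measurableT_comp.
- by split=> -[x y] /=; rewrite ?phi1K ?phi2K ?psi1K ?psi2K.
move=> A mA; rewrite /product_measure1 -[RHS](integral_rescale _ _ H1).
rewrite preimage_setT -ge0_integralZl//.
- apply: eq_integral => x _ /=; rewrite EFinM -muleA.
  by rewrite -(cmu2 (xsection A (phi1 x)))//; exact: measurable_xsection.
- apply: measurable_fun_xsection.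
  by rewrite -[X in measurable X]setTI; exact: mphi.
- by rewrite lee_fin ltW// mulr_gt0.
Qed.

(** By uniqueness of Lebesgue measure it suffices that [a] times the pushforward under
    multiplication by [a] gives half-open intervals their length. *)
Lemma lebesgue_rescales (a : R) : (0 < a)%R ->
  rescales (@lebesgue_measure R) a ( *%R a) ( *%R a^-1).
Proof.
move=> a0; have mM (b : R) :
    measurable_fun setT ( *%R b : measurableTypeR R -> measurableTypeR R).
  exact: mulrl_measurable.
have aK : cancel ( *%R a) ( *%R a^-1) by apply: mulKf; rewrite gt_eqF.
split=> //; first by split=> //; apply: mulVKf; rewrite gt_eqF.
have [nu nuE] := pushforward_can_sigma_finite
  (sigma_finiteT (@lebesgue_measure R)) (mM a) (mM a^-1)%R aK.
have {}nuE A : lebesgue_measure ( *%R a @^-1` A) = nu A.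
  by rewrite -nuE.
move=> A mA; rewrite nuE.
apply/esym.
apply: (lebesgue_measure_unique (mu := mscale (NngNum (ltW a0)) nu)) => //.
move=> _ [[b c]] _ <-; rewrite /mscale /= -[X in _ = _ * X]nuE.
rewrite (_ : _ @^-1` _ = `](a^-1 * b)%R, (a^-1 * c)%R]%classic); last first.
  apply/seteqP; split=> x /=; rewrite !in_itv/=;
    by rewrite ltr_pdivrMl// ler_pdivlMl.
rewrite !lebesgue_measure_itv/= !lte_fin ltr_pM2l ?invr_gt0//.
case: ifP => _; last by rewrite mule0.
by rewrite -!EFinB -EFinM mulrBr !mulVKf// gt_eqF.
Qed.

Section matrix.
Variables (a : R) (a0 : (0 < a)%R).

Lemma measurable_scale_tuple (b : R) n :
  measurable_fun setT
    (@map_tuple n (measurableTypeR R) (measurableTypeR R) ( *%R b)).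
Proof.
apply/measurable_fun_tnthP => i.
rewrite (_ : _ \o _ = ( *%R b) \o (fun t => tnth t i)).
  apply: measurableT_comp; last exact: measurable_tnth.
  exact: mulrl_measurable.
by apply/funext => t /=; rewrite tnth_map.
Qed.

(** Induction on the length: each coordinate contributes one factor [a], as scaling commutes with
    [tuple_cons]. *)
Lemma lebesgue_tuple_rescales n :
  rescales (@lebesgue_tuple R n) (a ^+ n)%R (map_tuple ( *%R a))
    (map_tuple ( *%R a^-1)).
Proof.
elim: n => [|n IH].
  split=> //; try exact: measurable_scale_tuple.
    by split=> t; apply: eq_from_tnth => -[].
  move=> A mA; rewrite expr0 mul1e /= (_ : _ @^-1` A = A)//.
  by apply/seteqP; split=> t /=; rewrite (_ : map_tuple _ t = t)//;
    apply: eq_from_tnth => -[].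
split; try exact: measurable_scale_tuple.
- exact: exprn_gt0.
- by split=> t; apply: eq_from_tnth => i;
    rewrite !tnth_map ?mulKf ?mulVKf ?gt_eqF.
move=> A mA; have [m mE] := lebesgue_tupleP R n; rewrite /= /pushforward.
move: IH; rewrite mE => IH.
have [_ _ _ _ E] := product_rescales (lebesgue_rescales a0) IH.
rewrite -[RHS]E; last first.
  rewrite -[X in measurable X]setTI.
  exact: measurable_tuple_cons.
rewrite exprS; congr (_ * (_ \x _) _); apply/seteqP; split=> -[x t] /=;
  by rewrite (_ : map_tuple _ _ = tuple_cons (a * x, map_tuple ( *%R a) t)%R)//;
     apply: val_inj.
Qed.

Lemma lebesgue_mx_rescales m n :
  rescales (@lebesgue_mx R m n) (a ^+ (m * n))%R ( *:%R a) ( *:%R a^-1).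
Proof.
have mZ (b : R) : measurable_fun setT ( *:%R b : 'M[R]_(m, n) -> 'M[R]_(m, n)).
  (* Measurability is transported from tuples, where it can be checked coordinatewise. *)
  rewrite (_ : *:%R b =
      @mx_of_tuple R m n \o map_tuple ( *%R b) \o @tuple_of_mx R m n).
    apply: measurableT_comp; last exact: measurable_tuple_of_mx.
    apply: measurableT_comp; first exact: measurable_mx_of_tuple.
    exact: measurable_scale_tuple.
  apply/funext => A /=; apply: (can_inj mxvecK).
  rewrite /mx_of_tuple vec_mxK; apply/rowP => k.
  by rewrite !mxE tnth_map tnth_mktuple /mx_coor linearZ mxE.
split=> //; first exact: exprn_gt0.
  by split; [apply: scalerK|apply: scalerKV]; rewrite gt_eqF.
move=> A mA; rewrite /lebesgue_mx /pushforward.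
have [_ _ _ _ E] := lebesgue_tuple_rescales (m * n).
rewrite -[RHS]E; last first.
  rewrite -[X in measurable X]setTI.
  exact: measurable_mx_of_tuple.
congr (_ * lebesgue_tuple _); apply/seteqP; split=> t /=;
  by rewrite (_ : mx_of_tuple (map_tuple _ t) = a *: mx_of_tuple t)%R//;
     rewrite /mx_of_tuple -linearZ; congr vec_mx; apply/rowP => k;
     rewrite !mxE tnth_map.
Qed.

End matrix.
End change_of_variables.

(** * Scaling of positive definite matrices, Gaussian densities and kernels *)

Section gaussian.
Context {R : realType} {n : nat}.
Implicit Types S : 'M[R]_n.

Lemma is_spdZ (a : R) S : 0 < a -> is_spd S -> is_spd (a *: S).
Proof.
move=> a0 [ST S0]; split=> [|v v0]; first by rewrite linearZ /= ST.
by rewrite -scalemxAr -scalemxAl mxE mulr_gt0// S0.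
Qed.

(** A nonzero row of the left kernel, transposed, would make the quadratic form vanish. *)
Lemma is_spd_unitmx S : is_spd S -> S \in unitmx.
Proof.
move=> [ST S0]; rewrite -row_free_unit -kermx_eq0; apply/eqP/row_matrixP => i.
rewrite row0; apply/eqP/negPn/negP => v0.
have /S0 : (row i (kermx S))^T != 0.
  by apply: contra_neq v0 => /(congr1 trmx); rewrite trmxK trmx0.
by rewrite trmxK -row_mul mulmx_ker row0 mul0mx mxE ltxx.
Qed.

(** The quadratic form is unchanged, while the determinant gains [a ^- 2 ^+ n], whose inverse square
    root is the Jacobian [a ^+ n]. *)
Lemma gauss_pdfZ (a : R) (m x : 'cV[R]_n) S : 0 < a -> S \in unitmx ->
  gauss_pdf (a^-1 *: m) (a ^- 2 *: S) x = a ^+ n * gauss_pdf m S (a *: x).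
Proof.
move=> a0 Su; have a_neq0 : a != 0 by rewrite gt_eqF.
rewrite /gauss_pdf (_ : x - a^-1 *: m = a^-1 *: (a *: x - m)); last first.
  by rewrite scalerBr scalerK.
rewrite detZ invmxZ ?unitmxZ ?unitfE ?invr_eq0 ?expf_neq0//.
rewrite invrK [(a^-1 *: _)^T]linearZ /= -!(scalemxAl, scalemxAr) !scalerA.
have -> : a^-1 * a^-1 * a ^+ 2 = 1 by field.
rewrite scale1r [RHS]mulrA; congr (_ * _).
have -> : a ^- 2 ^+ n = (a ^- n) ^+ 2 by rewrite !exprVn -!exprM mulnC.
rewrite mulrCA sqrtrM ?exprn_ge0 ?invr_ge0 ?exprn_ge0 ?ltW// sqrtr_sqr.
by rewrite ger0_norm ?invr_ge0 ?exprn_ge0 ?ltW// invfM invrK.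
Qed.

Lemma gauss_pdf_ge0 (m x : 'cV[R]_n) S : 0 <= gauss_pdf m S x.
Proof. by rewrite /gauss_pdf mulr_ge0 ?invr_ge0 ?sqrtr_ge0 ?expR_ge0. Qed.

End gaussian.

Lemma psd_kernelZ (R : realType) (X : Type) (a : R) (k : X -> X -> R) :
  0 <= a -> psd_kernel k -> psd_kernel (fun x y => a * k x y).
Proof.
move=> a0 [kC k0]; split=> [x y|m x c]; first by rewrite kC.
have := mulr_ge0 a0 (k0 m x c); rewrite mulr_sumr.
under eq_bigr do rewrite mulr_sumr.
by under eq_bigr do under eq_bigr do rewrite mulrCA.
Qed.

(** * Invariance of the Kullback-Leibler divergence *)

Section kl_div.
Local Open Scope ereal_scope.

(* When [q] or [p] vanishes, [lne] is infinite: the finite term [lne c] cancels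
   in the difference in all cases. *)
Lemma kl_div_rescale (R : realType) d (X : measurableType d)
    (mu : {measure set X -> \bar R}) (c : R) phi psi (q p : X -> R) :
  rescales mu c phi psi -> (forall x, 0 <= q x)%R -> (forall x, 0 <= p x)%R ->
  kl_div mu (fun x => c * q (phi x))%R (fun x => c * p (phi x))%R =
  kl_div mu q p.
Proof.
move=> H q0 p0; have [c0 _ _ _ _] := H.
have lneZ (r : R) : (0 <= r)%R -> lne (c * r)%:E = (ln c)%:E + lne r%:E.
  rewrite le_eqVlt => /predU1P[<-|r0].
    by rewrite mulr0 /= lexx.
  by rewrite !lne_EFin ?mulr_gt0// lnM.
rewrite /kl_div -[RHS](integral_rescale _ _ H) preimage_setT.
apply: eq_integral => x _; rewrite !lneZ// EFinM -muleA; congr (_ * (_ * _)).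
case: (lne _) (lne _) => [u| |] [v| |] //=.
by rewrite -!EFinD opprD addrACA subrr add0r.
Qed.

End kl_div.

(** * The rescaled parameters and equality of the bounds *)

Section rescale_params.
Context (R : realType) (L M Dy : nat) (D : 'I_L -> nat).
Implicit Types (th : params R M Dy D) (a : R).

Definition rescale_params a th : params R M Dy D :=
  {| kern l x y := a ^- 2 * kern th x y;
     Qnoise l := a^-1 *: Qnoise th l;
     mu0 := mu0 th; Q0 := Q0 th; m0 := m0 th; S0 := S0 th;
     mM l d := a^-1 *: mM th d;
     SM l d := a ^- 2 *: SM th d;
     Cobs := Cobs th; Omega := Omega th |}.

Context (z : forall l, 'I_M -> 'cV[R]_(D l)) (th : params R M Dy D) (a : R).
Hypotheses (a0 : 0 < a) (adm : admissible z th).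

Let a_neq0 : a != 0. Proof. by rewrite gt_eqF. Qed.
Let aV0 : 0 < a^-1. Proof. by rewrite invr_gt0. Qed.
Let aV20 : 0 < a ^- 2. Proof. by rewrite invr_gt0 exprn_gt0. Qed.

Let KMM_rescale l : KMM z (rescale_params a th) l = a ^- 2 *: KMM z th l.
Proof. by apply/matrixP => i j; rewrite !mxE. Qed.

Let KxM_rescale l (x : 'cV[R]_(D l)) :
  KxM z (rescale_params a th) x = a ^- 2 *: KxM z th x.
Proof. by apply/matrixP => i j; rewrite !mxE. Qed.

Let KMM_unit l : KMM z th l \in unitmx. Proof. by case: adm. Qed.

Let KMM_rescale_unit l : KMM z (rescale_params a th) l \in unitmx.
Proof. by rewrite KMM_rescale unitmxZ// unitfE gt_eqF. Qed.

Let weights_rescale l (x : 'cV[R]_(D l)) :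
  KxM z (rescale_params a th) x *m invmx (KMM z (rescale_params a th) l) =
  KxM z th x *m invmx (KMM z th l).
Proof.
rewrite KxM_rescale KMM_rescale invmxZ -?KMM_rescale//.
by rewrite -scalemxAl -scalemxAr scalerA mulfV ?scale1r// gt_eqF.
Qed.

Lemma admissible_rescale : admissible z (rescale_params a th).
Proof.
have [mk psdk _ spd spdO] := adm; split=> //.
- move=> l; apply: measurable_funM => //; exact: mk.
- by move=> l; apply: psd_kernelZ; rewrite ?ltW//; exact: psdk.
- move=> l; have [? ? ? spdS] := spd l; split=> //=; first exact: is_spdZ.
  by move=> d; exact: is_spdZ.
Qed.

(** The drift is linear in [f] with unchanged weights, so the step length moves onto [f]; in the
    covariance the powers of [a] cancel. *)
Lemma em_transition_rescale l (x x' : 'cV[R]_(D l)) (f : 'M[R]_(M, D l)) :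
  em_transition z (rescale_params a th) a x x' f =
  gp_transition z th x x' (a *: f).
Proof.
have driftE : a *: drift z (rescale_params a th) x f = drift z th x (a *: f).
  apply/colP => d; rewrite mxE [X in _ * X]mxE [RHS]mxE.
  by rewrite weights_rescale [col d (_ *: _)]linearZ -scalemxAr [RHS]mxE.
have covE : a ^+ 2 *: cond_cov z (rescale_params a th) x = cond_cov z th x.
  rewrite /cond_cov weights_rescale KxM_rescale scale_scalar_mx /=.
  rewrite [(_ *: _)^T]linearZ -scalemxAr mxE -mulrBr mulrA mulfV ?mul1r//.
  by rewrite gt_eqF// exprn_gt0.
rewrite /em_transition /gp_transition driftE covE /= scalerA mulfV//.
by rewrite scale1r [cond_cov z th x + Qnoise _ _]addrC.
Qed.

(** Serves both the variational factor and the prior of the inducing outputs: each of the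
    [\sum_l D l] densities on [R^M] contributes [a ^+ M]. *)
Let prod_gauss_rescale (m : forall l, 'I_(D l) -> 'cV[R]_M)
    (S : forall l, 'I_(D l) -> 'M[R]_M) (f : 'M[R]_(M, \sum_(l < L) D l)) :
  (forall l d, S l d \in unitmx) ->
  \prod_(l < L) \prod_(d < D l)
    gauss_pdf (a^-1 *: m l d) (a ^- 2 *: S l d) (col d (submxrow f l)) =
  a ^+ (M * \sum_(l < L) D l) * \prod_(l < L) \prod_(d < D l)
    gauss_pdf (m l d) (S l d) (col d (submxrow (a *: f) l)).
Proof.
move=> Su; rewrite exprM expr_sum -big_split; apply: eq_bigr => l _ /=.
under eq_bigr => d _ do rewrite gauss_pdfZ//.
rewrite big_split /= prodr_const card_ord; congr (_ * _).
apply: eq_bigr => d _; congr gauss_pdf.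
by apply/colP => i; rewrite !mxE.
Qed.

Lemma var_f_rescale f : var_f (rescale_params a th) f =
  a ^+ (M * \sum_(l < L) D l) * var_f th (a *: f).
Proof.
apply: prod_gauss_rescale => l d; apply: is_spd_unitmx.
by have [_ _ _ /(_ l)[_ _ _]] := adm.
Qed.

Lemma prior_f_rescale f : prior_f z (rescale_params a th) f =
  a ^+ (M * \sum_(l < L) D l) * prior_f z th (a *: f).
Proof.
rewrite -(prod_gauss_rescale (fun l d => 0))//.
apply: eq_bigr => l _; apply: eq_bigr => d _.
by rewrite scaler0 KMM_rescale.
Qed.

Lemma var_marginal_rescale J (t : 'I_J.+1) :
  var_marginal (rescale_params a th)
    (em_transition z (rescale_params a th) a) t =
  var_marginal th (gp_transition z th) t.
Proof.
apply/funext => A; rewrite /var_marginal /pushforward /var_posterior_law.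
(* Only [f] is scaled, so the domain, a condition on the trajectory alone, is its own preimage; the
   Jacobian is the factor gained by [var_f]. *)
rewrite -[RHS](integral_rescale _ _ (product_rescales
  (rescales_id _) (lebesgue_mx_rescales a0 M (\sum_(l < L) D l)))).
apply: eq_integral => -[x f] _ /=; rewrite mul1r -EFinM; congr EFin.
rewrite /var_posterior /= var_f_rescale mulrCA -!mulrA.
congr (_ * (_ * (_ * _))).
apply: eq_bigr => s _; apply: eq_bigr => l _.
rewrite em_transition_rescale; congr (gp_transition _ _ _ _ _).
by apply/matrixP => i j; rewrite !mxE.
Qed.

Lemma elbo_rescale J obs :
  elbo z (rescale_params a th) (em_transition z (rescale_params a th) a) J obs =
  elbo z th (gp_transition z th) J obs.
Proof.
have klE : kl_div (@lebesgue_mx R M (\sum_(l < L) D l))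
    (var_f (rescale_params a th)) (prior_f z (rescale_params a th)) =
    kl_div (@lebesgue_mx R M (\sum_(l < L) D l)) (var_f th) (prior_f z th).
  rewrite (funext var_f_rescale) (funext prior_f_rescale).
  have := kl_div_rescale (lebesgue_mx_rescales a0 M (\sum_(l < L) D l)).
  by apply => f; apply: prodr_ge0 => l _; apply: prodr_ge0 => d _;
    exact: gauss_pdf_ge0.
by rewrite /elbo klE (funext (@var_marginal_rescale J)).
Qed.

End rescale_params.

(** Choosing [Phi] before all else makes the new parameters a function of [Dt] and [th] only, hence
    independent of the observations. *)
Theorem theorem2 (R : realType) (L M Dy : nat) (D : 'I_L -> nat) :
  exists Phi : R -> params R M Dy D -> params R M Dy D,
    forall (Dt : R) (T : nat) (z : forall l : 'I_L, 'I_M -> 'cV[R]_(D l))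
      (th : params R M Dy D),
      0 < Dt -> admissible z th ->
      admissible z (Phi Dt th) /\
      forall y : nat -> 'cV[R]_Dy,
        elbo_gp z th T y = elbo_sde z (Phi Dt th) Dt 1 T y.
Proof.
exists (@rescale_params R L M Dy D) => Dt T z th Dt0 adm.
split=> [|y]; first exact: admissible_rescale.
(* At resolution 1 the observation indices, the number of steps and the step length reduce to [j],
   [T] and [Dt]. *)
have yE : (fun j => y (j * 1)%N) = y by apply/funext => j; rewrite muln1.
by rewrite /elbo_sde yE (divn1 T) (mul1r Dt) elbo_rescale.
Qed.
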